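(* Let $\alpha>2$, and let $V\subset\mathbb{R}^2$ be a finite set of $N_L\ge 2$ distinct points (legitimate nodes) with two distinct designated nodes $A_S,A_D\in V$. Let $\mathcal{L}$ be the set of all paths from $A_S$ to $A_D$, and for $L\in\mathcal{L}$ let $W(L)=\sum_{i\in L}d_{A_iA_{i+1}}^{\alpha}$ be the sum over the hops of $L$. For each $u\in\{1,\dots,N_L-1\}$ let $\hat L_u$ be a minimizer of $\left(u\,W(L)\right)^{2/\alpha}$ over all $L\in\mathcal{L}$ with $|L|\le u$. Then $$\min_{L\in\mathcal{L}}\left(|L|\,W(L)\right)^{\frac{2}{\alpha}}=\min_{1\le u\le N_L-1}\left(|\hat L_u|\,W(\hat L_u)\right)^{\frac{2}{\alpha}}.$$ Consequently, the following algorithm outputs a path attaining the minimum on the left-hand side: (1) run the Bellman-Ford shortest path algorithm from $A_S$ with link weights $d_{A_iA_{j}}^{\alpha}$ and, for each $u=1,\dots,N_L-1$, record as $\hat L_u$ the path to $A_D$ that is shortest among those with at most $u$ hops, found at iteration $u$; (2) compute $(|\hat L_u|W(\hat L_u))^{2/\alpha}$ for each $u$; (3) output a path $\hat L_u$ with the smallest computed value. Its computational complexity is $O(N_L^3)$.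
   Context: $d_{XY}$ is the Euclidean distance between the points $X,Y$. A path from $A_S$ to $A_D$ is a sequence of distinct nodes of $V$ starting at $A_S$ and ending at $A_D$; any two distinct nodes may be consecutive. $|L|$ denotes the number of hops (links) of $L$. Complexity counts elementary operations on real numbers (additions, multiplications, comparisons, evaluation of powers) at unit cost. *)

(* Defs.v *)
From mathcomp Require Import all_boot all_order all_algebra.
From mathcomp Require Import all_classical all_reals all_analysis.

Set Implicit Arguments.
Unset Strict Implicit.
Unset Printing Implicit Defensive.

Import Order.TTheory GRing.Theory Num.Theory.
Local Open Scope classical_set_scope.
Local Open Scope ring_scope.

Definition is_min (R : realType) (E : set R) (m : R) : Prop :=
  E m /\ lbound E m.

Definition minimizer (R : realType) (T : Type) (P : set T) (f : T -> R)
    (x : T) : Prop :=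
  P x /\ forall y, P y -> f x <= f y.

(* [R * R] carries the max norm in the library, hence an explicit distance. *)
Definition eucl_dist (R : realType) (X Y : R * R) : R :=
  Num.sqrt ((X.1 - Y.1) ^+ 2 + (X.2 - Y.2) ^+ 2).

(* The nodes are the points [A i], [i : 'I_N], with [A] injective. A path is
   the sequence of all its nodes, both ends included. *)
Definition paths (N : nat) (src dst : 'I_N) : set (seq 'I_N) :=
  [set L | ohead L = Some src /\ last src L = dst /\ uniq L].

Definition hops (T : Type) (L : seq T) : nat := (size L).-1.

Definition weight (R : realType) (alpha : R) (N : nat) (A : 'I_N -> R * R)
    (L : seq 'I_N) : R :=
  \sum_(e <- zip L (behead L)) eucl_dist (A e.1) (A e.2) `^ alpha.

Definition objective (R : realType) (alpha : R) (N : nat) (A : 'I_N -> R * R)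
    (L : seq 'I_N) : R :=
  ((hops L)%:R * weight alpha A L) `^ (2 / alpha).

Definition is_hop_limited_minimizer (R : realType) (alpha : R) (N : nat)
    (A : 'I_N -> R * R) (src dst : 'I_N) (u : nat) (L : seq 'I_N) : Prop :=
  minimizer [set L' | paths src dst L' /\ (hops L' <= u)%N]
    (fun L' => (u%:R * weight alpha A L') `^ (2 / alpha)) L.

(* Programs over real numbers. The algorithms below are parametric in the type
   [K] of numbers, so that they can create, combine or compare numbers only
   through the constructors [Lit], [Add], [Mul], [Pow] and [Leq]; [cost] charges
   one unit for each of these. Subtraction, division and square root are
   obtained from multiplication by -1 and the powers -1 and 1/2. *)
Inductive prog (K X : Type) : Type :=
| Ret of X
| Lit of int & (K -> prog K X)
| Add of K & K & (K -> prog K X)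
| Mul of K & K & (K -> prog K X)
| Pow of K & K & (K -> prog K X)
| Leq of K & K & (bool -> prog K X).

Arguments Ret {K X}.

Fixpoint bind (K X Y : Type) (p : prog K X) (f : X -> prog K Y) : prog K Y :=
  match p with
  | Ret x => f x
  | Lit z k => Lit z (fun a => bind (k a) f)
  | Add x y k => Add x y (fun a => bind (k a) f)
  | Mul x y k => Mul x y (fun a => bind (k a) f)
  | Pow x y k => Pow x y (fun a => bind (k a) f)
  | Leq x y k => Leq x y (fun b => bind (k b) f)
  end.

Notation "'let!' x ':=' p 'in' q" := (bind p (fun x => q))
  (at level 200, x name, p at level 200, q at level 200).

Fixpoint value (R : realType) (X : Type) (p : prog R X) : X :=
  match p with
  | Ret x => x
  | Lit z k => value (k z%:~R)
  | Add x y k => value (k (x + y))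
  | Mul x y k => value (k (x * y))
  | Pow x y k => value (k (x `^ y))
  | Leq x y k => value (k (x <= y))
  end.

Fixpoint cost (R : realType) (X : Type) (p : prog R X) : nat :=
  match p with
  | Ret _ => 0
  | Lit z k => (cost (k z%:~R)).+1
  | Add x y k => (cost (k (x + y))).+1
  | Mul x y k => (cost (k (x * y))).+1
  | Pow x y k => (cost (k (x `^ y))).+1
  | Leq x y k => (cost (k (x <= y))).+1
  end.

Section Algorithm.

Variable K : Type.

Definition lit (z : int) : prog K K := Lit z Ret.
Definition add (x y : K) : prog K K := Add x y Ret.
Definition mul (x y : K) : prog K K := Mul x y Ret.
Definition pow (x y : K) : prog K K := Pow x y Ret.
Definition leq_prog (x y : K) : prog K bool := Leq x y Ret.

Fixpoint tabulate (X : Type) (n : nat) :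
    ('I_n -> prog K X) -> prog K (n.-tuple X) :=
  match n with
  | 0 => fun _ => Ret [tuple]
  | n'.+1 => fun f =>
      let! x := f ord0 in
      let! t := tabulate (fun i => f (lift ord0 i)) in
      Ret (cons_tuple x t)
  end.

Fixpoint mapM (X Y : Type) (f : X -> prog K Y) (s : seq X) : prog K (seq Y) :=
  if s is x :: s' then
    let! y := f x in
    let! t := mapM f s' in
    Ret (y :: t)
  else Ret [::].

Fixpoint foldM (X Y : Type) (f : Y -> X -> prog K Y) (y : Y) (s : seq X) :
    prog K Y :=
  if s is x :: s' then
    let! z := f y x in
    foldM f z s'
  else Ret y.

Definition link_weight (alpha : K) (X Y : K * K) : prog K K :=
  let! minus1 := lit (-1) in
  let! two := lit 2 in
  let! half := pow two minus1 in
  let! y1 := mul minus1 Y.1 in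
  let! dx := add X.1 y1 in
  let! y2 := mul minus1 Y.2 in
  let! dy := add X.2 y2 in
  let! dx2 := mul dx dx in
  let! dy2 := mul dy dy in
  let! s := add dx2 dy2 in
  let! d := pow s half in
  pow d alpha.

Variable N : nat.

(* Label of a node in the Bellman-Ford algorithm: the weight of the best path
   found so far and this path, or [None] (infinite weight) if there is none yet.
   Within the iterations paths are kept in reverse order, so that extending one
   by a link is a single cons. *)
Definition label : Type := option (K * seq 'I_N).

(* Compare the current best label of [v] with the extension to [v], by a link of
   weight [c], of a path with label [lw]. *)
Definition relax (c : K) (v : 'I_N) (best lw : label) : prog K label :=
  if lw is Some (d, p) then
    let! d' := add d c in
    if best is Some (b, _) then
      let! keep := leq_prog b d' in
      Ret (if keep then best else Some (d', v :: p))
    else Ret (Some (d', v :: p))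
  else Ret best.

Definition bf_init (src : 'I_N) : prog K (N.-tuple label) :=
  let! zero := lit 0 in
  Ret [tuple if v == src then Some (zero, [:: src]) else None | v < N].

(* All labels are updated from those of the previous iteration, so that after
   [u] iterations they only involve paths with at most [u] hops. *)
Definition bf_step (c : N.-tuple (N.-tuple K)) (lab : N.-tuple label) :
    prog K (N.-tuple label) :=
  tabulate (fun v =>
    foldM (fun best w => relax (tnth (tnth c w) v) v best (tnth lab w))
      (tnth lab v) [seq w <- enum 'I_N | w != v]).

Fixpoint bf_iter (c : N.-tuple (N.-tuple K)) (dst : 'I_N) (n : nat)
    (lab : N.-tuple label) : prog K (seq label) :=
  if n is n'.+1 then
    let! lab' := bf_step c lab in
    let! records := bf_iter c dst n' lab' in
    Ret (omap (fun r => (r.1, rev r.2)) (tnth lab' dst) :: records)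
  else Ret [::].

(* The entry of index [u.-1] is the record made at iteration [u] for [dst], with
   the path in its natural order. *)
Definition bellman_ford (alpha : K) (A : 'I_N -> K * K) (src dst : 'I_N) :
    prog K (seq label) :=
  let! c := tabulate (fun i => tabulate (fun j =>
              link_weight alpha (A i) (A j))) in
  let! lab := bf_init src in
  bf_iter c dst N.-1 lab.

Definition score (e : K) (r : label) : prog K label :=
  if r is Some (w, L) then
    let! h := lit (hops L)%:Z in
    let! x := mul h w in
    let! y := pow x e in
    Ret (Some (y, L))
  else Ret None.

Definition better (best r : label) : prog K label :=
  match best, r with
  | Some (b, _), Some (y, _) =>
      let! keep := leq_prog b y in
      Ret (if keep then best else r)
  | None, _ => Ret r
  | _, None => Ret best
  end.

Definition algorithm (alpha : K) (A : 'I_N -> K * K) (src dst : 'I_N) :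
    prog K (option (seq 'I_N)) :=
  let! records := bellman_ford alpha A src dst in
  let! two := lit 2 in
  let! minus1 := lit (-1) in
  let! inv_alpha := pow alpha minus1 in
  let! e := mul two inv_alpha in
  let! scores := mapM (score e) records in
  let! best := foldM better None scores in
  Ret (omap snd best).

End Algorithm.

(* Main.v *)
Require Import Defs.
From mathcomp Require Import all_boot all_order all_algebra.
From mathcomp Require Import all_classical all_reals all_analysis.
From mathcomp Require Import zify.

Set Implicit Arguments.
Unset Strict Implicit.
Unset Printing Implicit Defensive.

Import Order.TTheory GRing.Theory Num.Theory.
Local Open Scope classical_set_scope.
Local Open Scope ring_scope.

(** A path with h hops is a candidate for the minimizer labelled h, which
    therefore has an objective no larger than that of the path: its weight and
    its hop count are both at most as large.  Bellman-Ford provides these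
    minimizers; since link weights are nonnegative and ties keep the old label,
    its labels are always simple paths. *)

(** * Values and costs of the program combinators *)

Section Programs.

Variable R : realType.

Lemma value_bind (X Y : Type) (p : prog R X) (f : X -> prog R Y) :
  value (bind p f) = value (f (value p)).
Proof. by elim: p => //= *. Qed.

Lemma cost_bind (X Y : Type) (p : prog R X) (f : X -> prog R Y) :
  cost (bind p f) = (cost p + cost (f (value p)))%N.
Proof.
by elim: p => //= [z|x y|x y|x y|x y] k IH; rewrite IH addSn.
Qed.

Lemma tnth_value_tabulate (X : Type) n (f : 'I_n -> prog R X) i :
  tnth (value (tabulate f)) i = value (f i).
Proof.
elim: n f i => [f []//|n IH f i] /=.
rewrite !value_bind /=; case: (unliftP ord0 i) => [j ->|->].
  by rewrite tnthS IH.
by rewrite tnth0.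
Qed.

Lemma cost_tabulate_le (X : Type) n (f : 'I_n -> prog R X) B :
  (forall i, cost (f i) <= B)%N -> (cost (tabulate f) <= n * B)%N.
Proof.
elim: n f => [//|n IH] f fB /=.
by rewrite !cost_bind /= addn0 mulSn leq_add ?IH.
Qed.

Lemma value_mapM (X Y : Type) (f : X -> prog R Y) s :
  value (mapM f s) = [seq value (f x) | x <- s].
Proof. by elim: s => //= x s IH; rewrite !value_bind /= IH. Qed.

Lemma cost_mapM_le (X Y : Type) (f : X -> prog R Y) s B :
  (forall x, cost (f x) <= B)%N -> (cost (mapM f s) <= size s * B)%N.
Proof.
move=> fB; elim: s => //= x s IH.
by rewrite !cost_bind /= addn0 mulSn leq_add.
Qed.

Lemma value_foldM (X Y : Type) (f : Y -> X -> prog R Y) y s :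
  value (foldM f y s) = foldl (fun a x => value (f a x)) y s.
Proof. by elim: s y => //= x s IH y; rewrite value_bind IH. Qed.

Lemma cost_foldM_le (X Y : Type) (f : Y -> X -> prog R Y) y s B :
  (forall a x, cost (f a x) <= B)%N -> (cost (foldM f y s) <= size s * B)%N.
Proof.
move=> fB; elim: s y => //= x s IH y.
by rewrite cost_bind mulSn leq_add.
Qed.

Lemma value_link_weight (alpha : R) (X Y : R * R) :
  value (link_weight alpha X Y) = eucl_dist X Y `^ alpha.
Proof.
(* The program takes the square root as the power [2^-1], which agrees with [Num.sqrt] on
   nonnegative arguments such as this sum of squares. *)
rewrite /= /eucl_dist powR_inv1 // powR12_sqrt; last first.
  by rewrite addr_ge0 // -expr2 sqr_ge0.
by rewrite !mulN1r !expr2.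
Qed.

End Programs.

(** * The order on labels and running minima *)

Section Labels.

Variables (R : realType) (N : nat).

Local Notation label := (label R N).

(* [None] stands for an infinite weight. *)
Definition label_le (a b : label) : bool :=
  match a, b with
  | _, None => true
  | None, Some _ => false
  | Some (x, _), Some (y, _) => x <= y
  end.

(** Ties go to [a], just as [relax] and [better] keep the current best label on equality. *)
Definition label_min (a b : label) : label := if label_le a b then a else b.

Lemma label_le_refl a : label_le a a.
Proof. by case: a => [[]|] /=. Qed.

Lemma label_le_trans b a c : label_le a b -> label_le b c -> label_le a c.
Proof.
by case: a b c => [[x ?]|] [[y ?]|] [[z ?]|] //=; exact: le_trans.
Qed.

Lemma label_minl a b : label_le (label_min a b) a.
Proof.
rewrite /label_min; case: ifP => [_|]; first exact: label_le_refl.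
by case: a b => [[x ?]|] [[y ?]|] //= /negbT; rewrite -ltNge => /ltW.
Qed.

Lemma label_minr a b : label_le (label_min a b) b.
Proof. by rewrite /label_min; case: ifP => // _; exact: label_le_refl. Qed.

(** The strictness in the last clause comes from ties keeping the old label; it is what later
    excludes cycles from the Bellman-Ford paths. *)
Lemma foldl_label_min (I : eqType) (f : I -> label) (b : label) (s : seq I) :
  let r := foldl (fun a i => label_min a (f i)) b s in
  [/\ label_le r b,
      forall i, i \in s -> label_le r (f i) &
      r = b \/ exists2 i, i \in s & r = f i /\ ~~ label_le b (f i)].
Proof.
elim: s b => [|i s IH] b /=; first by split=> //; [exact: label_le_refl|left].
have [le_r le_rs r_in] := IH (label_min b (f i)).
split; first exact: label_le_trans le_r (label_minl _ _).
  move=> j; rewrite inE => /predU1P[->|/le_rs//].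
  exact: label_le_trans le_r (label_minr _ _).
case: r_in => [->|[j js [-> nle]]].
  rewrite {1 2}/label_min; case: ifPn => bi; first by left.
  by right; exists i; rewrite ?mem_head.
right; exists j; first by rewrite inE js orbT.
(* The label [f j] is strictly below the minimum of [b] and [f i], hence strictly below [b]. *)
by split=> //; apply: contra nle; apply: label_le_trans (label_minl _ _).
Qed.

Definition extend (c : R) (v : 'I_N) (l : label) : label :=
  omap (fun r => (r.1 + c, v :: r.2)) l.

Lemma value_relax c v (b l : label) :
  value (relax c v b l) = label_min b (extend c v l).
Proof. by case: b l => [[x p]|] [[y q]|]. Qed.

Lemma cost_relax_le c v (b l : label) : (cost (relax c v b l) <= 2)%N.
Proof. by case: b l => [[x p]|] [[y q]|]. Qed.

Lemma value_better (b l : label) : value (better b l) = label_min b l.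
Proof. by case: b l => [[x p]|] [[y q]|]. Qed.

Lemma cost_better_le (b l : label) : (cost (better b l) <= 1)%N.
Proof. by case: b l => [[x p]|] [[y q]|]. Qed.

Lemma cost_score_le (e : R) (l : label) : (cost (score e l) <= 3)%N.
Proof. by case: l => [[x p]|]. Qed.

End Labels.

(** * Correctness of the Bellman-Ford iterations *)

Section BellmanFord.

Variables (R : realType) (N : nat) (c : 'I_N -> 'I_N -> R).

Definition path_weight (L : seq 'I_N) : R :=
  \sum_(e <- zip L (behead L)) c e.1 e.2.

(** The two parts share the node [v], so no link is lost at the joint. *)
Lemma path_weight_cat L v M :
  path_weight (rcons L v ++ M) = path_weight (rcons L v) + path_weight (v :: M).
Proof.
rewrite /path_weight; elim: L => [|x L IH] /=; first by rewrite big_nil add0r.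
case: L IH => [|y L] /= IH; first by rewrite !big_cons big_nil addr0.
by rewrite big_cons IH [in RHS]big_cons addrA.
Qed.

Lemma path_weight_rcons L w v :
  path_weight (rcons (rcons L w) v) = path_weight (rcons L w) + c w v.
Proof.
by rewrite -[rcons (rcons L w) v]cats1 path_weight_cat /path_weight /= big_seq1.
Qed.

Hypothesis c_ge0 : forall i j, 0 <= c i j.

Lemma path_weight_ge0 L : 0 <= path_weight L.
Proof. exact: sumr_ge0. Qed.

Variable src : 'I_N.

Lemma paths_rcons w v L :
  paths src w L -> v \notin L -> paths src v (rcons L v).
Proof.
case: L => [[]//|x L] [hd [_ uL]] vL.
split; first by rewrite rcons_cons.
by rewrite last_rcons rcons_uniq vL uL.
Qed.

(** Cutting the path right after [v] drops only links of nonnegative weight. *)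
Lemma paths_prefix w v L : paths src w L -> v \in L ->
  exists L', [/\ paths src v L', (hops L' <= hops L)%N &
                 path_weight L' <= path_weight L].
Proof.
move=> LP vL; case/path.splitP: vL LP => L1 L2 [hd [_ uL]].
exists (rcons L1 v); split.
- split; first by move: hd; case: L1 {uL}.
  by rewrite last_rcons; move: uL; rewrite cat_uniq => /andP[].
- by rewrite /hops size_cat !size_rcons addSn leq_addr.
- by rewrite path_weight_cat lerDl path_weight_ge0.
Qed.

(* Each label is a simple path of at most [k] hops, kept reversed, and no
   lighter such path exists. *)
Definition bf_correct (k : nat) (lab : 'I_N -> label R N) : Prop :=
  forall v,
    (forall d p, lab v = Some (d, p) ->
       [/\ paths src v (rev p), (hops p <= k)%N & d = path_weight (rev p)]) /\
    (forall L, paths src v L -> (hops L <= k)%N ->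
       exists d p, lab v = Some (d, p) /\ d <= path_weight L).

Lemma bf_correct_init : bf_correct 0 (tnth (value (bf_init R src))).
Proof.
move=> v; rewrite /= tnth_mktuple; split.
  move=> d p; case: eqP => // -> [<- <-].
  by split=> //; rewrite /path_weight /= big_nil.
(* A path without hops is a single node, so it can only end at [src]. *)
case=> [[]//|x [|//]] [[->] [/= -> _]] _.
by exists 0, [:: v]; rewrite eqxx path_weight_ge0.
Qed.

Variable C : N.-tuple (N.-tuple R).
Hypothesis CE : forall w v, tnth (tnth C w) v = c w v.

Lemma tnth_value_bf_step (lab : N.-tuple (label R N)) v :
  tnth (value (bf_step C lab)) v =
  foldl (fun b w => label_min b (extend (c w v) v (tnth lab w)))
    (tnth lab v) [seq w <- enum 'I_N | w != v].
Proof.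
rewrite tnth_value_tabulate value_foldM.
elim: [seq _ <- _ | _] (tnth lab v) => //= w s IH b.
by rewrite IH value_relax CE.
Qed.

(** For the lower bound, a path with at most [k.+1] hops is split at its penultimate node [w]: the
    label of [w] after [k] iterations is no heavier than the part up to [w], and relaxing the link
    from [w] to [v] adds the rest. *)
Lemma bf_correct_step k (lab : N.-tuple (label R N)) :
  bf_correct k (tnth lab) -> bf_correct k.+1 (tnth (value (bf_step C lab))).
Proof.
move=> IH v; rewrite tnth_value_bf_step.
set r := foldl _ _ _.
have [le_rv le_rw r_in] := foldl_label_min
  (fun w => extend (c w v) v (tnth lab w)) (tnth lab v)
  [seq w <- enum 'I_N | w != v].
rewrite -/r in le_rv le_rw r_in.
split.
  move=> d p rE; case: r_in => [rv|[w _ [rw nle]]].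
    have [pP pk ->] := (IH v).1 d p (etrans (esym rv) rE).
    by split=> //; exact: leqW.
  case lw : (tnth lab w) rw nle => [[d0 p0]|]; last by rewrite rE.
  rewrite rE /= => -[-> ->] nle.
  have [p0P p0k d0E] := (IH w).1 _ _ lw.
  (* Otherwise the part of the path up to [v] is at least as good. *)
  have vp0 : v \notin rev p0.
    apply: contra nle => vp0.
    have [L [LP Lk LW]] := paths_prefix p0P vp0.
    have [|d1 [p1 [-> d1L]]] := (IH v).2 L LP.
      by apply: leq_trans Lk _; rewrite /hops size_rev.
    by rewrite /= d0E (le_trans d1L) // (le_trans LW) // lerDl.
  rewrite rev_cons; split; first exact: paths_rcons p0P vp0.
    by move: p0P p0k; case: p0 {lw d0E vp0 nle} => [|x p0] // [].
  case/lastP: (rev p0) p0P d0E => [[]//|q x] [_ []].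
  by rewrite last_rcons => -> _ ->; rewrite path_weight_rcons.
move=> L; case/lastP: L => [[]//|L x] LP; have := LP => -[hd [+ uL]].
rewrite last_rcons => xv; subst x.
(* The path [[:: v]] has no penultimate node, but the old label of [v] already covers it and the new
   one is no heavier. *)
case/lastP: L LP hd uL => [|L w] LP hd uL Lk.
  have [//|d [p [lv dL]]] := (IH v).2 _ LP.
  move: le_rv; rewrite lv; case: (r) => [[d' p']|] //= dd'.
  by exists d', p'; split=> //; exact: le_trans dL.
move: uL; rewrite rcons_uniq mem_rcons inE negb_or => /andP[/andP[vw _] uL].
have wP : paths src w (rcons L w).
  by split; [move: hd; case: (L)|rewrite last_rcons].
have [|d [p [lw dL]]] := (IH w).2 _ wP.
  by move: Lk; rewrite /hops !size_rcons.
have /le_rw : w \in [seq w <- enum 'I_N | w != v].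
  by rewrite mem_filter eq_sym vw mem_enum.
rewrite lw; case: (r) => [[d' p']|] //= dd'.
exists d', p'; split=> //; rewrite path_weight_rcons (le_trans dd') //.
by rewrite lerD2r.
Qed.

Lemma bf_correct_iter k :
  bf_correct k (tnth (iter k (fun lab => value (bf_step C lab))
                        (value (bf_init R src)))).
Proof.
elim: k => [|k IH]; first exact: bf_correct_init.
exact: bf_correct_step.
Qed.

Lemma value_bf_iter dst n (lab : N.-tuple (label R N)) :
  value (bf_iter C dst n lab) =
  mkseq (fun k => omap (fun r => (r.1, rev r.2))
    (tnth (iter k.+1 (fun lab => value (bf_step C lab)) lab) dst)) n.
Proof.
elim: n lab => [//|n IH] lab /=.
rewrite !value_bind /= IH /mkseq /= -[1%N]/(1 + 0)%N iotaDl -map_comp.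
by congr (_ :: _); apply: eq_map => k /=; rewrite -iterSr.
Qed.

End BellmanFord.

(** * The cubic cost bound *)

Section Costs.

Variables (R : realType) (N : nat).

(** Each of the [N] nodes has at most [N] incoming links, and relaxing one takes at most an addition
    and a comparison. *)
Lemma cost_bf_step_le (C : N.-tuple (N.-tuple R)) (lab : N.-tuple (label R N)) :
  (cost (bf_step C lab) <= N * (N * 2))%N.
Proof.
apply: cost_tabulate_le => v; apply: leq_trans (_ : _ <= size _ * 2)%N _.
  by apply: cost_foldM_le => *; exact: cost_relax_le.
rewrite leq_mul2r /= size_filter (leq_trans (count_size _ _)) //.
by rewrite size_enum_ord.
Qed.

Lemma cost_bf_iter_le (C : N.-tuple (N.-tuple R)) dst n
    (lab : N.-tuple (label R N)) :
  (cost (bf_iter C dst n lab) <= n * (N * (N * 2)))%N.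
Proof.
elim: n lab => //= n IH lab.
by rewrite !cost_bind /= addn0 mulSn leq_add // cost_bf_step_le.
Qed.

(** The link weights cost at most [12 * N ^ 2], the iterations at most [2 * N ^ 3], scoring and
    selection at most [4 * N], and five operations remain; 30 exceeds the sum of these
    coefficients. *)
Lemma cost_algorithm_le (alpha : R) (A : 'I_N -> R * R) src dst :
  (0 < N)%N -> (cost (algorithm alpha A src dst) <= 30 * N ^ 3)%N.
Proof.
move=> N0; rewrite /algorithm /bellman_ford !(cost_bind, value_bind).
set C := value (tabulate _).
set t1 := cost (tabulate _).
(* The constant 12 is the number of operations in [link_weight]. *)
have t1_le : (t1 <= N * (N * 12))%N.
  by apply: cost_tabulate_le => i; apply: cost_tabulate_le => j.
set t2 := cost (bf_iter _ _ _ _).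
have t2_le : (t2 <= N.-1 * (N * (N * 2)))%N by exact: cost_bf_iter_le.
set rs := value (bf_iter _ _ _ _).
have srs : size rs = N.-1 by rewrite /rs value_bf_iter size_mkseq.
set e := value (Defs.mul _ _).
have := cost_mapM_le rs (fun l => cost_score_le e l).
set t3 := cost (mapM _ _) => t3_le.
have ss : size (value (mapM (score e) rs)) = N.-1.
  by rewrite value_mapM size_map.
have := cost_foldM_le None (value (mapM (score e) rs))
  (fun a l => cost_better_le a l).
set t4 := cost (foldM _ _ _) => t4_le.
rewrite /= in t1_le t2_le t3_le t4_le *.
move: t3_le t4_le; rewrite ss srs => t3_le t4_le.
clearbody t1 t2 t3 t4; clear -t1_le t2_le t3_le t4_le N0.
case: N N0 t1_le t2_le t3_le t4_le => // n _ /= *; nia.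
Qed.

End Costs.

(** * Reduction to hop-limited minimizers and correctness of the algorithm *)

Section Objective.

Variables (R : realType) (alpha : R) (N : nat) (A : 'I_N -> R * R).
Variables (src dst : 'I_N).
Hypotheses (alpha_gt0 : 0 < alpha) (src_dst : src != dst).

Let link (i j : 'I_N) : R := eucl_dist (A i) (A j) `^ alpha.

Lemma weight_ge0 L : 0 <= weight alpha A L.
Proof. by apply: sumr_ge0 => e _; exact: powR_ge0. Qed.

Lemma powR_weight_le (x y : R) : 0 <= x -> x <= y ->
  x `^ (2 / alpha) <= y `^ (2 / alpha).
Proof.
move=> x0 xy; apply: ge0_ler_powR => //; last exact: le_trans xy.
by rewrite divr_ge0 // ltW.
Qed.

(** A path has at most [N] nodes since they are distinct, and at least two since its ends differ.
    Hence the hop count of any path is an admissible index [u]. *)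
Lemma hops_bounds L : paths src dst L -> (1 <= hops L <= N.-1)%N.
Proof.
case: L => [[]//|x [|y L]] [[->] [/= e]].
  by move: src_dst; rewrite e eqxx.
move=> uL; have /card_uniqP : uniq [:: src, y & L] by [].
have := max_card (mem [:: src, y & L]); rewrite card_ord => + cE.
by rewrite cE /hops /= ltn_predRL.
Qed.

(** For fixed [u] the minimized quantity is a nondecreasing function of the weight. *)
Lemma weight_minimizer_hop_limited u L :
  minimizer [set L' | paths src dst L' /\ (hops L' <= u)%N]
    (weight alpha A) L ->
  is_hop_limited_minimizer alpha A src dst u L.
Proof.
case=> LP Lmin; split=> // L' L'P; apply: powR_weight_le.
  by rewrite mulr_ge0 ?weight_ge0.
by rewrite ler_wpM2l // Lmin.
Qed.

Section HopLimited.

Variable Lhat : nat -> seq 'I_N.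
Hypothesis Lhat_min : forall u, (1 <= u <= N.-1)%N ->
  is_hop_limited_minimizer alpha A src dst u (Lhat u).

Lemma objective_Lhat_hops L : paths src dst L ->
  objective alpha A (Lhat (hops L)) <= objective alpha A L.
Proof.
move=> LP; have [[LhP hL] hmin] := Lhat_min (hops_bounds LP).
(* With h the hop count of [L] and M the path [Lhat h], the chain is |M| W(M) <= h W(M) <= h W(L):
   the hop limit gives the first inequality, minimality of M the second. *)
apply: le_trans (hmin L (conj LP (leqnn _))); apply: powR_weight_le.
  by rewrite mulr_ge0 ?weight_ge0.
by rewrite ler_wpM2r ?weight_ge0 // ler_nat.
Qed.

(** The best index does at least as well as the index [hops L], whose path does at least as well as
    [L]. *)
Lemma minimizer_Lhat u :
  minimizer [set u : nat | (1 <= u <= N.-1)%N]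
    (fun u => objective alpha A (Lhat u)) u ->
  minimizer (paths src dst) (objective alpha A) (Lhat u).
Proof.
case=> uN umin; split; first by have [[]] := Lhat_min uN.
move=> L LP; apply: le_trans (objective_Lhat_hops LP).
exact/umin/hops_bounds.
Qed.

Lemma exists_minimizer_Lhat : (2 <= N)%N ->
  exists u, minimizer [set u : nat | (1 <= u <= N.-1)%N]
    (fun u => objective alpha A (Lhat u)) u.
Proof.
move=> N2; have N1 : (0 < N.-1)%N by rewrite -ltnS prednK // ltnW.
pose i0 := Ordinal N1.
(* The ordinal [i] stands for the index [u = i.+1], which turns the range of [u] into a finite
   type. *)
pose obj (i : 'I_N.-1) := objective alpha A (Lhat i.+1).
case: (@arg_minP _ _ _ i0 xpredT obj) => // i _ imin.
exists i.+1; split=> /=; first exact: ltn_ord.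
by case=> // u /= uN; exact: (imin (Ordinal uN)).
Qed.

Lemma is_min_objective : (2 <= N)%N ->
  exists m : R,
    is_min [set objective alpha A L | L in paths src dst] m /\
    is_min [set objective alpha A (Lhat u) |
              u in [set u : nat | (1 <= u <= N.-1)%N]] m.
Proof.
move=> N2; have [u umin] := exists_minimizer_Lhat N2.
have [LP Lmin] := minimizer_Lhat umin; have [uN umin'] := umin.
exists (objective alpha A (Lhat u)); split; split.
- by exists (Lhat u).
- by move=> _ [L /Lmin + <-].
- by exists u.
- by move=> _ [v /umin' + <-].
Qed.

End HopLimited.

Lemma bellman_ford_correct u : (1 <= u <= N.-1)%N ->
  exists L : seq 'I_N,
    nth None (value (bellman_ford alpha A src dst)) u.-1
      = Some (weight alpha A L, L) /\
    minimizer [set L' | paths src dst L' /\ (hops L' <= u)%N]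
      (weight alpha A) L.
Proof.
case: u => [//|u] /= uN; rewrite /bellman_ford !value_bind.
set C := value (tabulate _).
have CE w v : tnth (tnth C w) v = link w v.
  by rewrite !tnth_value_tabulate value_link_weight.
have link_ge0 i j : 0 <= link i j by exact: powR_ge0.
rewrite value_bf_iter nth_mkseq //.
have [snd cmpl] := bf_correct_iter link_ge0 src CE u.+1 dst.
(* The direct link is a path with one hop, so the record for [dst] is never [None], already from the
   first iteration. *)
have edge : paths src dst [:: src; dst].
  by split=> //; split=> //=; rewrite inE src_dst.
have [//|d [p [labE _]]] := cmpl _ edge.
rewrite labE; have [pP pu dE] := snd _ _ labE.
exists (rev p); split; first by rewrite /= dE.
split; first by split=> //; move: pu; rewrite /hops size_rev.
move=> L [LP Lu]; have [d' [p' []]] := cmpl L LP Lu.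
by rewrite labE => -[<- _]; rewrite dE.
Qed.

Lemma size_value_bellman_ford :
  size (value (bellman_ford alpha A src dst)) = N.-1.
Proof. by rewrite /bellman_ford !value_bind value_bf_iter size_mkseq. Qed.

Lemma algorithm_correct : (2 <= N)%N ->
  exists L : seq 'I_N,
    value (algorithm alpha A src dst) = Some L /\
    minimizer (paths src dst) (objective alpha A) L.
Proof.
move=> N2; set rs := value (bellman_ford alpha A src dst).
(* The default [[::]] does not occur for [u] between 1 and [N.-1], where every record is a path. *)
pose Lhat u : seq 'I_N := if nth None rs u.-1 is Some (_, L) then L else [::].
have LhatP u : (1 <= u <= N.-1)%N ->
    nth None rs u.-1 = Some (weight alpha A (Lhat u), Lhat u) /\
    is_hop_limited_minimizer alpha A src dst u (Lhat u).
  move=> /bellman_ford_correct[L [E /weight_minimizer_hop_limited Lmin]].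
  by rewrite /Lhat /rs E.
pose f u : label R N := Some (objective alpha A (Lhat u), Lhat u).
have scoresE : [seq value (score (2 / alpha) r) | r <- rs] =
    [seq f u | u <- iota 1 N.-1].
  apply: (@eq_from_nth _ None).
    by rewrite !size_map size_iota size_value_bellman_ford.
  move=> i; rewrite size_map => irs.
  have iN : (i < N.-1)%N by rewrite -size_value_bellman_ford.
  rewrite (nth_map None) // (nth_map 0%N) ?size_iota // nth_iota // add1n.
  by have [-> _] := LhatP i.+1 iN.
have valueE : value (algorithm alpha A src dst) =
    omap snd (foldl (fun a u => label_min a (f u)) None (iota 1 N.-1)).
  rewrite /algorithm value_bind -/rs !value_bind /= powR_inv1 ?ltW //.
  rewrite value_foldM value_mapM [map _ _]scoresE; congr omap.
  elim: (iota _ _) (None : label R N) => //= u s IH b.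
  by rewrite IH value_better.
have [_ le_r r_in] := foldl_label_min f None (iota 1 N.-1).
rewrite valueE; move: le_r r_in; set r := foldl _ _ _ => le_r r_in.
(* The fold cannot still be at its initial [None]: as [2 <= N], the index 1 occurs and has a finite
   score. So the result is the score of some [u], and no other score is smaller. *)
have [rN|[u ui [rE _]]] := r_in.
  have := le_r 1%N.
  by rewrite rN mem_iota /= add1n ltnS ltn_predRL N2 => /(_ isT).
exists (Lhat u); split; first by rewrite rE.
apply: minimizer_Lhat => [v /LhatP[]//|]; split.
  by move: ui; rewrite mem_iota add1n ltnS.
move=> v /= vN; have := le_r v; rewrite rE /=; apply.
by rewrite mem_iota add1n ltnS.
Qed.

End Objective.

Theorem mainTheorem5 (R : realType) :
  (forall (alpha : R) (N : nat) (A : 'I_N -> R * R) (src dst : 'I_N),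
     2 < alpha -> (2 <= N)%N -> injective A -> src != dst ->
     (forall Lhat : nat -> seq 'I_N,
        (forall u : nat, (1 <= u <= N.-1)%N ->
           is_hop_limited_minimizer alpha A src dst u (Lhat u)) ->
        (exists m : R,
           is_min [set objective alpha A L | L in paths src dst] m /\
           is_min [set objective alpha A (Lhat u) |
                     u in [set u : nat | (1 <= u <= N.-1)%N]] m) /\
        (forall u : nat,
           minimizer [set u : nat | (1 <= u <= N.-1)%N]
             (fun u => objective alpha A (Lhat u)) u ->
           minimizer (paths src dst) (objective alpha A) (Lhat u))) /\
     (forall u : nat, (1 <= u <= N.-1)%N ->
        exists L : seq 'I_N,
          nth None (value (bellman_ford alpha A src dst)) u.-1
            = Some (weight alpha A L, L) /\
          minimizer [set L' | paths src dst L' /\ (hops L' <= u)%N]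
            (weight alpha A) L /\
          is_hop_limited_minimizer alpha A src dst u L) /\
     (exists L : seq 'I_N,
        value (algorithm alpha A src dst) = Some L /\
        minimizer (paths src dst) (objective alpha A) L)) /\
  (exists C : nat,
     forall (alpha : R) (N : nat) (A : 'I_N -> R * R) (src dst : 'I_N),
       2 < alpha -> (2 <= N)%N -> injective A -> src != dst ->
       (cost (algorithm alpha A src dst) <= C * N ^ 3)%N).
Proof.
split.
  move=> alpha N A src dst alpha2 N2 _ sd.
  have alpha0 : 0 < alpha by exact: lt_trans alpha2.
  split.
    move=> Lhat Lhat_min; split; first exact: (is_min_objective alpha0 sd).
    by move=> u; exact: minimizer_Lhat.
  split; last exact: algorithm_correct.
  move=> u uN; have [L [E Lmin]] := bellman_ford_correct alpha A sd uN.
  by exists L; split=> //; split=> //; exact: weight_minimizer_hop_limited.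
exists 30%N => alpha N A src dst _ N2 _ _.
by apply: cost_algorithm_le; exact: ltnW.
Qed.
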